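(* For $i=1,2$ let $\mathscr{L}_i$ be a language and $\mathfrak{M}_i$ a uniquely listable $\mathscr{L}_i$-structure with domain $M_i$. Suppose $\mathfrak{M}_2$ has the DPRM property and that there are p.e. interpretations $\theta_1:\mathfrak{M}_1\dashrightarrow\mathfrak{M}_2$ and $\theta_2:\mathfrak{M}_2\dashrightarrow\mathfrak{M}_1$ of ranks $r_1,r_2$. Let $\zeta=\theta_2\bullet\theta_1:\mathfrak{M}_1\dashrightarrow\mathfrak{M}_1$ and $r=r_1r_2$. The following are equivalent: (i) $(\theta_1,\theta_2)$ is a p.e. bi-interpretation between $\mathfrak{M}_1$ and $\mathfrak{M}_2$; (ii) $\Gamma(\zeta)\subseteq M_1^{r+1}$ is p.e. $\mathscr{L}_1$-definable over $\mathfrak{M}_1$; (iii) $\mathfrak{M}_1$ has the DPRM property.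
   Context: All languages contain $=$, interpreted as equality. Listable means recursively enumerable. For $\rho:A\to B$ and $S\subseteq B^r$, $\rho^{(r)}$ is the coordinatewise map $A^r\to B^r$ and $\rho^*(S)=(\rho^{(r)})^{-1}(S)$. A listable presentation of an $\mathscr{L}$-structure $\mathfrak{M}$ (domain $M$) is a surjection $\rho:\mathbb{N}\to M$ with $\rho^*(s^{\mathfrak{M}})$ listable for every symbol $s$ (function symbols via graphs); $X\subseteq M^r$ is totally listable if $\rho^*(X)$ is listable for all listable presentations $\rho$. Presentations $\rho,\gamma$ are equivalent if $\gamma=\rho\circ\phi$ for a total recursive $\phi$; uniquely listable means a listable presentation exists and all are equivalent. P.e. formulas use only atomic formulas, $\wedge,\vee,\exists$; definable means without parameters. DPRM property: every totally listable subset of every $M^r$ is p.e. definable. A p.e. interpretation $\theta:\mathfrak{M}\dashrightarrow\mathfrak{N}$ of rank $r$ ($\mathfrak{N}$ a $\mathscr{K}$-structure with domain $N$) is a surjection $\theta:\mathrm{dom}(\theta)\to N$, $\mathrm{dom}(\theta)\subseteq M^r$ p.e. $\mathscr{L}$-definable, with $\theta^*(s^{\mathfrak{N}})$ p.e. $\mathscr{L}$-definable for all $s\in\mathscr{K}$. The composition $\theta_2\bullet\theta_1$ of $\theta_1:\mathfrak{M}_1\dashrightarrow\mathfrak{M}_2$ and $\theta_2:\mathfrak{M}_2\dashrightarrow\mathfrak{M}_3$ has domain $\theta_1^*(\mathrm{dom}(\theta_2))$ and is the map $\theta_2\circ\theta_1^{(\mathrm{rank}\,\theta_2)}$; its rank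 is the product of ranks. $\Gamma(\theta)=\{(x_0,\mathbf{x}):\mathbf{x}\in\mathrm{dom}(\theta),x_0=\theta(\mathbf{x})\}$. A pair $(\theta_1,\theta_2)$ of p.e. interpretations $\theta_1:\mathfrak{M}_1\dashrightarrow\mathfrak{M}_2$, $\theta_2:\mathfrak{M}_2\dashrightarrow\mathfrak{M}_1$ is a p.e. bi-interpretation if $\Gamma(\theta_1\bullet\theta_2)$ is p.e. definable over $\mathfrak{M}_2$ and $\Gamma(\theta_2\bullet\theta_1)$ is p.e. definable over $\mathfrak{M}_1$. *)

(* Defs.v *)
From mathcomp Require Import all_boot.
From mathcomp Require Import boolp classical_sets.

Set Implicit Arguments.
Unset Strict Implicit.
Unset Printing Implicit Defensive.

Local Open Scope classical_set_scope.

(** Partial recursive functions: codes and their graphs. *)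

Inductive prf : nat -> Type :=
| Zero n : prf n
| Succ : prf 1
| Proj n (i : 'I_n) : prf n
| Comp n m (f : prf m) (g : 'I_m -> prf n) : prf n
| Prec n (f : prf n) (g : prf n.+2) : prf n.+1
| Mini n (f : prf n.+1) : prf n.

(** [eval c x y]: the function coded by [c] is defined at [x], with value [y].
    For [Prec], [s i] is the value at [i :: behead x], the recursion variable
    coming first; for [Mini], the variable being minimised comes first. *)
Fixpoint eval n (c : prf n) : n.-tuple nat -> nat -> Prop :=
  match c in prf n return n.-tuple nat -> nat -> Prop with
  | Zero _ => fun _ y => y = 0
  | Succ => fun x y => y = (thead x).+1
  | Proj _ i => fun x y => y = tnth x i
  | Comp _ m f g => fun x y =>
      exists2 z : m.-tuple nat,
        (forall i, eval (g i) x (tnth z i)) & eval f z y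
  | Prec _ f g => fun x y =>
      exists s : nat -> nat,
        [/\ eval f (behead_tuple x) (s 0),
            forall i, i < thead x ->
              eval g [tuple of i :: s i :: behead x] (s i.+1)
          & y = s (thead x)]
  | Mini _ f => fun x y =>
      eval f [tuple of y :: x] 0 /\
      forall i, i < y -> exists v, eval f [tuple of i :: x] v.+1
  end.

Definition total_recursive (phi : nat -> nat) : Prop :=
  exists c : prf 1, forall n, eval c [tuple n] (phi n).

Definition listable r (A : set (r.-tuple nat)) : Prop :=
  A = set0 \/
  exists2 f : 'I_r -> nat -> nat,
    (forall i, total_recursive (f i)) &
    A = range (fun n => [tuple f i n | i < r]).

(** Equality is not listed among the relation symbols of a [language]: it is
    added to every language by [symbol] and [peform] below. *)
Record language := Language {
  fsym : Type;
  farity : fsym -> nat;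
  rsym : Type;
  rarity : rsym -> nat
}.

Record structure (L : language) (M : Type) := Structure {
  fun_interp : forall f : fsym L, (farity f).-tuple M -> M;
  rel_interp : forall R : rsym L, set ((rarity R).-tuple M)
}.
Arguments fun_interp {L M} _ f _.
Arguments rel_interp {L M} _ R _.

Inductive symbol (L : language) :=
| SEq
| SFun of fsym L
| SRel of rsym L.
Arguments SEq {L}.

Definition arity L (s : symbol L) : nat :=
  match s with
  | SEq => 2
  | SFun f => (farity f).+1
  | SRel R => rarity R
  end.

(** Function symbols are interpreted by their graphs, value first. *)
Definition sym_interp L M (MM : structure L M) (s : symbol L) :
    set ((arity s).-tuple M) :=
  match s return set ((arity s).-tuple M) with
  | SEq => [set x | tnth x ord0 = tnth x ord_max]
  | SFun f => [set x | thead x = fun_interp MM f (behead_tuple x)]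
  | SRel R => rel_interp MM R
  end.
Arguments sym_interp {L M} MM s _.

Inductive term (L : language) (n : nat) :=
| TVar (i : 'I_n)
| TApp (f : fsym L) (a : 'I_(farity f) -> term L n).

(** Positive existential formulas with free variables among [0, ..., n - 1];
    [PEx] binds variable [0] and shifts the others. *)
Inductive peform (L : language) : nat -> Type :=
| PEq n (t u : term L n) : peform L n
| PRel n (R : rsym L) (a : 'I_(rarity R) -> term L n) : peform L n
| PAnd n (p q : peform L n) : peform L n
| POr n (p q : peform L n) : peform L n
| PEx n (p : peform L n.+1) : peform L n.

Section Semantics.
Context (L : language) (M : Type) (MM : structure L M).

Fixpoint teval n (x : n.-tuple M) (t : term L n) : M :=
  match t with
  | TVar i => tnth x i
  | TApp f a => fun_interp MM f [tuple teval x (a i) | i < farity f]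
  end.

Fixpoint sat n (phi : peform L n) : n.-tuple M -> Prop :=
  match phi in peform _ n return n.-tuple M -> Prop with
  | PEq _ t u => fun x => teval x t = teval x u
  | PRel _ R a => fun x =>
      rel_interp MM R [tuple teval x (a i) | i < rarity R]
  | PAnd _ p q => fun x => sat p x /\ sat q x
  | POr _ p q => fun x => sat p x \/ sat q x
  | PEx _ p => fun x => exists y, sat p [tuple of y :: x]
  end.

Definition pe_definable r (X : set (r.-tuple M)) : Prop :=
  exists phi : peform L r, X = [set x | sat phi x].

Definition listable_presentation (rho : nat -> M) : Prop :=
  range rho = setT /\
  forall s : symbol L, listable (map_tuple rho @^-1` sym_interp MM s).

Definition totally_listable r (X : set (r.-tuple M)) : Prop :=
  forall rho, listable_presentation rho -> listable (map_tuple rho @^-1` X).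

Definition equivalent_presentations (rho gamma : nat -> M) : Prop :=
  exists2 phi, total_recursive phi & gamma =1 rho \o phi.

Definition uniquely_listable : Prop :=
  (exists rho, listable_presentation rho) /\
  forall rho gamma, listable_presentation rho -> listable_presentation gamma ->
    equivalent_presentations rho gamma.

Definition DPRM : Prop :=
  forall r (X : set (r.-tuple M)), totally_listable X -> pe_definable X.

End Semantics.

(** A partial map from [M^r] to [N]; the values of [pval] outside [pdom] are
    irrelevant. *)
Record partial_map (r : nat) (M N : Type) := PMap {
  pdom : set (r.-tuple M);
  pval :> r.-tuple M -> N
}.

Lemma block_index_subproof r k (j : 'I_k) (i : 'I_r) : j * r + i < r * k.
Proof.
rewrite (mulnC r) (leq_trans (n := j.+1 * r)) ?leq_mul2r ?ltn_ord ?orbT //.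
by rewrite mulSn addnC ltn_add2r.
Qed.

(** [M^(r * k)] is identified with [(M^r)^k]: a tuple of length [r * k] is the
    concatenation of [k] blocks of length [r]. *)
Definition block r k M (x : (r * k).-tuple M) (j : 'I_k) : r.-tuple M :=
  [tuple tnth x (Ordinal (block_index_subproof j i)) | i < r].

Definition partial_map_pow r k M N (theta : partial_map r M N) (x : (r * k).-tuple M) :
    k.-tuple N :=
  [tuple theta (block x j) | j < k].

Definition pullback r k M N (theta : partial_map r M N) (S : set (k.-tuple N)) :
    set ((r * k).-tuple M) :=
  [set x | (forall j, pdom theta (block x j)) /\ S (partial_map_pow theta x)].

Definition interp_comp r1 r2 M1 M2 M3 (theta2 : partial_map r2 M2 M3)
    (theta1 : partial_map r1 M1 M2) : partial_map (r1 * r2) M1 M3 :=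
  PMap (pullback theta1 (pdom theta2)) (theta2 \o partial_map_pow theta1).

Definition Gamma r M (theta : partial_map r M M) : set (r.+1.-tuple M) :=
  [set x : r.+1.-tuple M | pdom theta (behead_tuple x) /\
           thead x = theta (behead_tuple x)].

Definition pe_interpretation L K M N (MM : structure L M) (NN : structure K N)
    r (theta : partial_map r M N) : Prop :=
  [/\ theta @` pdom theta = setT,
      pe_definable MM (pdom theta)
    & forall s : symbol K, pe_definable MM (pullback theta (sym_interp NN s))].

Definition pe_bi_interpretation L1 L2 M1 M2
    (MM1 : structure L1 M1) (MM2 : structure L2 M2) r1 r2
    (theta1 : partial_map r1 M1 M2) (theta2 : partial_map r2 M2 M1) : Prop :=
  [/\ pe_interpretation MM1 MM2 theta1,
      pe_interpretation MM2 MM1 theta2,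
      pe_definable MM2 (Gamma (interp_comp theta1 theta2))
    & pe_definable MM1 (Gamma (interp_comp theta2 theta1))].

(* Main.v *)
(** Totally listable sets pull back along p.e. interpretations: composing a
    presentation [rho] of the source with [theta] and a recursive enumeration of
    [rho^*(dom theta)] gives a presentation of the target. Hence, if [Gamma zeta]
    is definable, a totally listable [X] is first pulled back to [M2], where the
    DPRM property defines it, then to [M1] along [theta1], and finally [X] is
    recovered from [zeta^*(X)] by quantifying over [zeta]-codes of its
    coordinates. Conversely, for a uniquely listable structure and a p.e.
    interpretation [theta] of it in itself, the composed presentation is
    [rho \o phi] with [phi] recursive, so the graph of [theta] is totally
    listable. Listable sets, definable sets and pullbacks of either are all
    families closed under conjunction, disjunction, renaming and projection, and
    such a family contains every p.e. definable set as soon as it contains the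
    symbols. *)

Require Import Defs.
From mathcomp Require Import all_boot.
From mathcomp Require Import boolp classical_sets.
From mathcomp Require Import zify.

Set Implicit Arguments.
Unset Strict Implicit.
Unset Printing Implicit Defensive.

Local Open Scope classical_set_scope.

(** * Total recursive functions and their closure properties *)

Definition recursive n (F : n.-tuple nat -> nat) : Prop :=
  exists c : prf n, forall x, eval c x (F x).

Definition recursive2 (f : nat -> nat -> nat) : Prop :=
  recursive (fun x : 2.-tuple nat => f (tnth x ord0) (tnth x ord_max)).

Lemma recursive_proj n (i : 'I_n) : recursive (fun x : n.-tuple nat => tnth x i).
Proof. by exists (Proj i). Qed.

Lemma recursive_comp m n (F : m.-tuple nat -> nat)
    (G : 'I_m -> n.-tuple nat -> nat) :
  recursive F -> (forall i, recursive (G i)) ->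
  recursive (fun x => F [tuple G i x | i < m]).
Proof.
move=> [c Fc] /choice[d Gd]; exists (Comp c d) => x /=.
by exists [tuple G i x | i < m] => // i; rewrite tnth_mktuple; apply: Gd.
Qed.

Lemma total_recursiveE f :
  total_recursive f <-> recursive (fun x : 1.-tuple nat => f (thead x)).
Proof.
split=> -[c fc]; exists c; last by move=> n; have := fc [tuple n].
move=> x; have -> : x = [tuple thead x]; last exact: fc.
by apply: val_inj; case: x => -[|a []].
Qed.

Lemma recursive_comp1 n f (G : n.-tuple nat -> nat) :
  total_recursive f -> recursive G -> recursive (fun x => f (G x)).
Proof.
move=> /total_recursiveE fr Gr.
have := recursive_comp (G := fun _ => G) fr (fun=> Gr).
by under eq_fun do rewrite /thead tnth_mktuple.
Qed.

Lemma recursive_comp2 n f (G H : n.-tuple nat -> nat) :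
  recursive2 f -> recursive G -> recursive H ->
  recursive (fun x => f (G x) (H x)).
Proof.
move=> fr Gr Hr.
have := recursive_comp (G := fun i : 'I_2 => if i == ord0 then G else H) fr.
under eq_fun do rewrite !tnth_mktuple /=.
by apply=> i; case: ifP.
Qed.

Lemma recursive_const n a : recursive (fun _ : n.-tuple nat => a).
Proof.
elim: a => [|a IHa]; first by exists (Zero n).
by apply: (recursive_comp1 (f := succn)) => //; exists Succ.
Qed.

(** The course of values that [Prec] asks for is [h] itself, so any function obeying the recursion
    equations is recursive, however it was defined. *)
Lemma recursive_prec n (F : n.-tuple nat -> nat) (G : n.+2.-tuple nat -> nat)
    (h : nat -> n.-tuple nat -> nat) :
  recursive F -> recursive G -> (forall y, h 0 y = F y) ->
  (forall i y, h i.+1 y = G [tuple of i :: h i y :: y]) ->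
  recursive (fun x : n.+1.-tuple nat => h (thead x) (behead_tuple x)).
Proof.
move=> [c Fc] [d Gd] h0 hS; exists (Prec c d) => x /=.
exists (h^~ (behead_tuple x)); split=> // [|i _]; first by rewrite h0.
rewrite hS; set t := (X in G X); set u := (X in eval d X).
by have -> : u = t by exact: val_inj.
Qed.

Lemma total_recursive_prec a g (h : nat -> nat) :
  recursive2 g -> h 0 = a -> (forall i, h i.+1 = g i (h i)) -> total_recursive h.
Proof.
move=> gr h0 hS; apply/total_recursiveE.
apply: (recursive_prec (n := 0) (h := fun i _ => h i) (recursive_const 0 a) gr).
  by [].
by move=> i y; rewrite hS.
Qed.

(** The step function sees the previous value and the parameter but not the index; addition,
    multiplication and truncated subtraction all fit this scheme. *)
Lemma recursive2_prec f g (h : nat -> nat -> nat) :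
  total_recursive f -> recursive2 g -> (forall y, h 0 y = f y) ->
  (forall i y, h i.+1 y = g (h i y) y) -> recursive2 h.
Proof.
move=> /total_recursiveE fr gr h0 hS; rewrite /recursive2.
have := recursive_prec (n := 1) (h := fun i y => h i (thead y)) fr
  (recursive_comp2 gr (recursive_proj (lift ord0 ord0)) (recursive_proj ord_max)).
rewrite (_ : (fun x : 2.-tuple nat => _) =
             fun x => h (tnth x ord0) (tnth x ord_max)).
  apply=> [y|i y]; first exact: h0.
  by rewrite hS !(tnth_nth 0) /= {2}/thead (tnth_nth 0).
apply/funext => x; rewrite /thead tnth_behead.
by have -> : inord (@ord0 0).+1 = @ord_max 1 by apply: val_inj; rewrite /= inordK.
Qed.

Lemma total_recursive_id : total_recursive id.
Proof. by apply/total_recursiveE; apply: recursive_proj. Qed.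

Lemma total_recursive_comp f g :
  total_recursive f -> total_recursive g -> total_recursive (f \o g).
Proof.
move=> fr /total_recursiveE gr; apply/total_recursiveE.
exact: recursive_comp1 fr gr.
Qed.

Lemma total_recursive_const a : total_recursive (fun=> a).
Proof. by apply/total_recursiveE/recursive_const. Qed.

Lemma total_recursive_comp2 f g h :
  recursive2 f -> total_recursive g -> total_recursive h ->
  total_recursive (fun n => f (g n) (h n)).
Proof.
by move=> fr /total_recursiveE gr /total_recursiveE hr;
  apply/total_recursiveE/recursive_comp2.
Qed.

Lemma recursive2_fst f : total_recursive f -> recursive2 (fun x _ => f x).
Proof. by move=> fr; apply: recursive_comp1 fr (recursive_proj _). Qed.

Lemma recursive2_snd f : total_recursive f -> recursive2 (fun _ y => f y).
Proof. by move=> fr; apply: recursive_comp1 fr (recursive_proj _). Qed.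

Lemma recursive2_comp2 f g h :
  recursive2 f -> recursive2 g -> recursive2 h ->
  recursive2 (fun x y => f (g x y) (h x y)).
Proof. exact: recursive_comp2. Qed.

Lemma recursive2_swap f : recursive2 f -> recursive2 (fun x y => f y x).
Proof. by move=> fr; apply: recursive_comp2 fr _ _; apply: recursive_proj. Qed.

Lemma total_recursive_succ : total_recursive succn.
Proof. by exists Succ. Qed.

Lemma total_recursive_pred : total_recursive predn.
Proof.
exact: (total_recursive_prec (a := 0) (recursive2_fst total_recursive_id)).
Qed.

Lemma recursive2_add : recursive2 addn.
Proof.
by apply: (recursive2_prec total_recursive_id (recursive2_fst total_recursive_succ)).
Qed.

Lemma recursive2_sub : recursive2 subn.
Proof.
(* The recursion runs on the first argument, while subtraction recurses on the subtrahend. *)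
apply: (recursive2_swap (f := fun x y => y - x)).
apply: (recursive2_prec (h := fun x y => y - x) total_recursive_id
  (recursive2_fst total_recursive_pred)).
  exact: subn0.
by move=> i y; rewrite subnS.
Qed.

Lemma recursive2_mul : recursive2 muln.
Proof.
apply: (recursive2_prec (total_recursive_const 0) recursive2_add) => // i y.
by rewrite mulSnr.
Qed.

Lemma total_recursive_if f g a b :
  total_recursive f -> total_recursive g -> total_recursive a ->
  total_recursive b ->
  total_recursive (fun n => if f n == g n then a n else b n).
Proof.
move=> fr gr ar br.
(* With truncated subtraction, the sum of the two differences is the distance of [f n] and [g n],
   and 1 minus that is the indicator of equality. *)
rewrite (_ : (fun n => _) = fun n =>
  (1 - ((f n - g n) + (g n - f n))) * a n +
  (1 - (1 - ((f n - g n) + (g n - f n)))) * b n); last first.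
  apply/funext => n; case: eqP => [->|/eqP fg].
    by rewrite subnn mul1n mul0n addn0.
  have -> : 1 - ((f n - g n) + (g n - f n)) = 0 by lia.
  by rewrite mul1n mul0n.
by repeat first [ exact: total_recursive_const | assumption
  | apply: total_recursive_comp2 recursive2_add _ _
  | apply: total_recursive_comp2 recursive2_mul _ _
  | apply: total_recursive_comp2 recursive2_sub _ _ ].
Qed.

(** * Integer square root, pairing and coding of finite tuples *)

(** The integer square root as a primitive recursion: the increment is 1 exactly when [n] has
    reached the next square. *)
Fixpoint root (n : nat) : nat :=
  if n is m.+1 then root m + (1 - ((root m).+1 * (root m).+1 - n)) else 0.

Lemma rootP n : root n * root n <= n < (root n).+1 * (root n).+1.
Proof.
elim: n => //= n /andP[rn nr].
case: (ltngtP n.+1 ((root n).+1 * (root n).+1)) => [lt_n|gt_n|eq_n].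
- have -> : 1 - ((root n).+1 * (root n).+1 - n.+1) = 0 by lia.
  by rewrite addn0 lt_n ltnW.
- by lia.
- by rewrite -eq_n subnn; nia.
Qed.

Lemma total_recursive_root : total_recursive root.
Proof.
have id1 := recursive2_fst total_recursive_succ.
have s2 := recursive2_snd total_recursive_succ.
apply: (total_recursive_prec (a := 0)
  (g := fun n s => s + (1 - (s.+1 * s.+1 - n.+1)))) => //.
apply: recursive2_comp2 recursive2_add (recursive2_snd total_recursive_id) _.
apply: recursive2_comp2 recursive2_sub (recursive2_fst (total_recursive_const 1)) _.
apply: recursive2_comp2 recursive2_sub _ id1.
exact: (recursive2_comp2 recursive2_mul s2 s2).
Qed.

(* [n |-> (unpairl n, unpairr n)] maps [(a + b)^2 + a] to [(a, b)]. *)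
Definition unpairl n := n - root n * root n.
Definition unpairr n := root n - unpairl n.

Lemma total_recursive_unpairl : total_recursive unpairl.
Proof.
apply: total_recursive_comp2 recursive2_sub total_recursive_id _.
exact: total_recursive_comp2 recursive2_mul total_recursive_root total_recursive_root.
Qed.

Lemma total_recursive_unpairr : total_recursive unpairr.
Proof.
exact: total_recursive_comp2 recursive2_sub total_recursive_root
  total_recursive_unpairl.
Qed.

Lemma unpair_surj a b : exists n, unpairl n = a /\ unpairr n = b.
Proof.
exists ((a + b) * (a + b) + a).
(* Since [a <= a + b], the code lies between the squares of [a + b] and [a + b + 1]. *)
have r_n : root ((a + b) * (a + b) + a) = a + b.
  have /andP[] := rootP ((a + b) * (a + b) + a); set s := root _ => s_le lt_s.
  by apply/eqP; rewrite eqn_leq; apply/andP; split; rewrite leqNgt; apply/negP; nia.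
by rewrite /unpairr /unpairl r_n; lia.
Qed.

(** Reads entry [k] of a right-nested pair. No length is stored, so one number serves as the code of
    every prefix. *)
Fixpoint unpack k n : nat := if k is k'.+1 then unpack k' (unpairr n) else unpairl n.

Lemma total_recursive_unpack k : total_recursive (unpack k).
Proof.
elim: k => [|k IHk]; first exact: total_recursive_unpairl.
exact: total_recursive_comp IHk total_recursive_unpairr.
Qed.

Lemma unpack_surj k (x : nat -> nat) : exists n, forall i, i < k -> unpack i n = x i.
Proof.
elim: k x => [|k IHk] x; first by exists 0.
have [m mP] := IHk (x \o succn); have [n [nl nr]] := unpair_surj (x 0) m.
by exists n => -[|i] //= i_lt; rewrite nr mP.
Qed.

(** Nested conditionals along [enum K] return 1 at the first equation that fails and 0 if none
    does. *)
Lemma total_recursive_eqs (K : finType) (g h : K -> nat -> nat) :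
  (forall k, total_recursive (g k)) -> (forall k, total_recursive (h k)) ->
  exists2 t, total_recursive t & forall n, t n = 0 <-> forall k, g k n = h k n.
Proof.
move=> gr hr.
suff [t tr tP] : exists2 t, total_recursive t &
    forall n, t n = 0 <-> {in enum K, forall k, g k n = h k n}.
  exists t => // n; rewrite tP; split=> [H k|H k _]; last exact: H.
  by apply: H; rewrite mem_enum.
elim: (enum K) => [|k s [t tr tP]].
  by exists (fun=> 0) => //; apply: total_recursive_const.
exists (fun n => if g k n == h k n then t n else 1).
  by apply: total_recursive_if => //; apply: total_recursive_const.
move=> n; split=> [|H].
  case: eqP => // gh /tP H j; rewrite inE => /predU1P[->//|]; exact: H.
rewrite H ?mem_head// eqxx; apply/tP => j js; apply: H.
by rewrite inE js orbT.
Qed.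

(** * Families of relations closed under positive existential operations *)

(** Coordinates are indexed by arbitrary finite types, so that blocks of auxiliary variables are
    sums and products of types rather than intervals of numbers. *)
Definition family U := forall I : finType, set (I -> U) -> Prop.

Lemma eq_family U (F : family U) (I : finType) (A B : set (I -> U)) :
  (forall x, A x <-> B x) -> F I A -> F I B.
Proof. by move=> AB; have -> : A = B by apply/funext => x; apply/propext. Qed.

Definition sumf (I J : finType) U (x : I -> U) (y : J -> U) (s : I + J) : U :=
  match s with inl i => x i | inr j => y j end.

(** In [ppR] the map [s] is arbitrary, which covers permuting and identifying variables as well as
    adding dummy ones; [ppE] projects a whole finite block at once. *)
Record pp_closed U (F : family U) : Prop := PPClosed {
  ppT : forall I, F I setT;
  ppI : forall I A B, F I A -> F I B -> F I (A `&` B);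
  ppU : forall I A B, F I A -> F I B -> F I (A `|` B);
  ppR : forall (I J : finType) (s : I -> J) A, F I A -> F J (fun x => A (x \o s));
  ppE : forall (I J : finType) A, F (I + J)%type A ->
    F I (fun x => exists y : J -> U, A (sumf x y))
}.

Section ClosedFamilies.
Context (U : Type) (F : family U).
Hypothesis Fpp : pp_closed F.

Lemma pp_forall (I K : finType) (A : K -> set (I -> U)) :
  (forall k, F (A k)) -> F (fun x => forall k, A k x).
Proof.
move=> FA.
apply: (@eq_family _ _ _ (fun x => {in enum K, forall k, A k x})).
  by move=> x; split=> [H k|H k _]; [apply: H; rewrite mem_enum | exact: H].
elim: (enum K) => [|k s IHs].
  by apply: (eq_family _ (ppT Fpp I)) => x; split.
apply: (eq_family _ (ppI Fpp (FA k) IHs)) => x; split=> [[Ak As] j|H].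
  by rewrite inE => /predU1P[->//|]; apply: As.
split; first by apply: H; rewrite mem_head.
by move=> j js; apply: H; rewrite inE js orbT.
Qed.

Lemma pp_rename (I J : finType) (s : I -> J) (A : set (I -> U)) (B : set (J -> U)) :
  F A -> (forall x, A (x \o s) <-> B x) -> F B.
Proof. by move=> FA AB; apply: eq_family AB (ppR Fpp s FA). Qed.

Lemma pp_exists (I J : finType) (A : set (I + J -> U)) (B : set (I -> U)) :
  F A -> (forall x, (exists y, A (sumf x y)) <-> B x) -> F B.
Proof. by move=> FA AB; apply: eq_family AB (ppE Fpp FA). Qed.

End ClosedFamilies.

(* Unlike [listable], this form treats the empty set uniformly. *)
Definition listable_family : family nat := fun I A =>
  exists (t : nat -> nat) (f : I -> nat -> nat),
  [/\ total_recursive t, forall i, total_recursive (f i) &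
      forall x, A x <-> exists n, t n = 0 /\ forall i, x i = f i n].

(** The side equations become one more zero test, and a sum of two tests vanishes only if both
    do. *)
Lemma listable_family_eqs (I K : finType) (f : I -> nat -> nat)
    (g h : K -> nat -> nat) (t : nat -> nat) :
  (forall i, total_recursive (f i)) -> (forall k, total_recursive (g k)) ->
  (forall k, total_recursive (h k)) -> total_recursive t ->
  listable_family (fun x => exists n, [/\ forall k, g k n = h k n, t n = 0 &
    forall i, x i = f i n]).
Proof.
move=> fr gr hr tr; have [u ur uP] := total_recursive_eqs gr hr.
exists (fun n => u n + t n), f; split=> //.
  exact: total_recursive_comp2 recursive2_add ur tr.
move=> x; split=> -[n].
  case=> ghn tn xf; exists n; split=> //.
  by rewrite tn addn0; apply/uP.
by case=> /eqP; rewrite addn_eq0 => /andP[/eqP /uP ? /eqP ?] ?; exists n.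
Qed.

Lemma listable_family_pp : pp_closed listable_family.
Proof.
have lr := total_recursive_unpairl; have rr := total_recursive_unpairr.
have cr a := total_recursive_const a.
have ur := total_recursive_unpack.
(* Every tuple is decoded from some number; the value 0 only fills positions outside ['I_#|I|]. *)
have unpackP (I : finType) (x : I -> nat) :
    exists n, forall i, x i = unpack (enum_rank i) n.
  have [n nP] := unpack_surj #|I| (fun k => if insub k is Some k' then
    x (enum_val (k' : 'I_#|I|)) else 0).
  by exists n => i; rewrite nP ?ltn_ord// valK enum_rankK.
split.
- move=> I; exists (fun=> 0), (fun i => unpack (enum_rank i)); split=> // x.
  by split=> // _; have [n nP] := unpackP _ x; exists n.
(* Intersection: run both enumerations on a pair of parameters and keep the pairs whose outputs
   agree. *)
- move=> I A B [t [f [tr fr AP]]] [u [g [ur' gr BP]]].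
  have := @listable_family_eqs I I (fun i => f i \o unpairl)
    (fun i => f i \o unpairl) (fun i => g i \o unpairr)
    (fun n => t (unpairl n) + u (unpairr n)).
  move=> H; apply: (eq_family _ (H _ _ _ _)).
  + move=> x; split=> [[n [fg tu xf]]|[/AP[n [tn xf]] /BP[m [um xg]]]].
      move/eqP: tu; rewrite addn_eq0 => /andP[/eqP tn /eqP un].
      split; first by apply/AP; exists (unpairl n).
      by apply/BP; exists (unpairr n); split=> // i; rewrite xf [LHS]fg.
    have [k [kl kr]] := unpair_surj n m; exists k; rewrite /= kl kr.
    by split=> [i||//]; [rewrite -xf -xg | rewrite tn um].
  + by move=> i; apply: total_recursive_comp.
  + by move=> i; apply: total_recursive_comp.
  + by move=> i; apply: total_recursive_comp.
  + by apply: total_recursive_comp2 recursive2_add _ _; apply: total_recursive_comp.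
(* Union: the left component of the parameter is a tag choosing the enumeration. *)
- move=> I A B [t [f [tr fr AP]]] [u [g [ur' gr BP]]].
  exists (fun n => if unpairl n == 0 then t (unpairr n) else u (unpairr n)).
  exists (fun i n => if unpairl n == 0 then f i (unpairr n) else g i (unpairr n)).
  split.
  + by apply: total_recursive_if => //; apply: total_recursive_comp.
  + by move=> i; apply: total_recursive_if => //; apply: total_recursive_comp.
  + move=> x; split=> [[/AP|/BP] [n nP]|[n]].
    * by have [k [kl kr]] := unpair_surj 0 n; exists k; rewrite kl kr.
    * by have [k [kl kr]] := unpair_surj 1 n; exists k; rewrite kl kr.
    * by case: eqP => _ nP; [left; apply/AP | right; apply/BP]; exists (unpairr n).
(* Renaming: the left component guesses a whole [J]-tuple, which is checked along [s] against the
   enumeration of [A] at the right component. *)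
- move=> I J s A [t [f [tr fr AP]]].
  have := @listable_family_eqs J I (fun j => unpack (enum_rank j) \o unpairl)
    (fun i => unpack (enum_rank (s i)) \o unpairl) (fun i => f i \o unpairr)
    (t \o unpairr).
  move=> H; apply: (eq_family _ (H _ _ _ _)).
  + move=> x; split=> [[n [uf tn xu]]|/AP[n [tn xf]]].
      by apply/AP; exists (unpairr n); split=> // i; rewrite -[RHS]uf -[RHS]xu.
    have [m mP] := unpackP _ x.
    have [k [kl kr]] := unpair_surj m n; exists k; rewrite /= kl kr.
    by split=> // i; rewrite -mP -xf.
  + by move=> i; apply: total_recursive_comp.
  + by move=> i; apply: total_recursive_comp.
  + by move=> i; apply: total_recursive_comp.
  + exact: total_recursive_comp.
(* Projection: the enumeration simply drops the coordinates in [J]. *)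
- move=> I J A [t [f [tr fr AP]]].
  exists t, (f \o inl); split=> // [i|x]; first exact: fr.
  split=> [[y /AP[n [tn xf]]]|[n [tn xf]]].
    by exists n; split=> // i; exact: (xf (inl i)).
  by exists (fun j => f (inr j) n); apply/AP; exists n; split=> // -[].
Qed.

Lemma tnth_mktupleK r U (x : 'I_r -> U) : tnth [tuple x i | i < r] = x.
Proof. by apply/funext => i; rewrite tnth_mktuple. Qed.

Lemma mktuple_tnthK r U (x : r.-tuple U) : [tuple tnth x i | i < r] = x.
Proof. by apply: eq_from_tnth => i; rewrite tnth_mktuple. Qed.

Lemma listableE r (A : set (r.-tuple nat)) :
  listable A <-> listable_family (fun x : 'I_r -> nat => A [tuple x i | i < r]).
Proof.
split=> [[->|[f fr ->]]|[t [f [tr fr AP]]]].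
- exists (fun=> 1), (fun _ _ => 0); split.
  + exact: total_recursive_const.
  + by move=> _; apply: total_recursive_const.
  + by move=> x; split=> // -[n []].
- exists (fun=> 0), f; split=> //; first exact: total_recursive_const.
  move=> x; split=> [[n _ /(congr1 (@tnth _ _))]|[n [_ xf]]].
    by rewrite !tnth_mktupleK => <-; exists n.
  by exists n => //; congr mktuple; apply/funext => i; rewrite xf.
(* If some parameter [n0] passes the test, its output replaces those of all failing parameters,
   which gives a total enumeration; otherwise the set is empty. *)
- case: (pselect (exists n0, t n0 = 0)) => [[n0 t0]|nt]; last first.
    left; apply/seteqP; split=> // x; rewrite -(mktuple_tnthK x) => /AP[n [tn _]].
    by apply: nt; exists n.
  right; exists (fun i n => if t n == 0 then f i n else f i n0).
    by move=> i; apply: total_recursive_if => //; apply: total_recursive_const.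
  apply/seteqP; split=> x.
    rewrite -{1}(mktuple_tnthK x) => /AP[n [tn xf]]; exists n => //.
    by apply: eq_from_tnth => i; rewrite tnth_mktuple tn eqxx xf.
  move=> [n _ <-]; case: eqP => tn; apply/AP; [exists n | exists n0]; by [].
Qed.

(** * Renaming of variables, and definable sets as the least closed family *)

Definition shift_rename n m (s : 'I_n -> 'I_m) (k : 'I_n.+1) : 'I_m.+1 :=
  if unlift ord0 k is Some j then lift ord0 (s j) else ord0.

Fixpoint rename_term L n m (s : 'I_n -> 'I_m) (t : term L n) : term L m :=
  match t with
  | TVar i => TVar L (s i)
  | TApp f a => TApp (fun i => rename_term s (a i))
  end.

(** The target arity and the renaming come after the formula because both change under [PEx]. *)
Fixpoint rename_form L n (phi : peform L n) : forall m, ('I_n -> 'I_m) -> peform L m :=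
  match phi in peform _ n return forall m, ('I_n -> 'I_m) -> peform L m with
  | PEq _ t u => fun m s => PEq (rename_term s t) (rename_term s u)
  | PRel _ R a => fun m s => PRel (fun i => rename_term s (a i))
  | PAnd _ p q => fun m s => PAnd (rename_form p s) (rename_form q s)
  | POr _ p q => fun m s => POr (rename_form p s) (rename_form q s)
  | PEx _ p => fun m s => PEx (rename_form p (shift_rename s))
  end.

Definition consf U n (u : U) (x : 'I_n -> U) (k : 'I_n.+1) : U :=
  if unlift ord0 k is Some j then x j else u.

Lemma mktuple_consf U n (u : U) (x : 'I_n -> U) :
  [tuple consf u x i | i < n.+1] = [tuple of u :: [tuple x i | i < n]].
Proof.
apply: eq_from_tnth => k; rewrite tnth_mktuple /consf.
by case: unliftP => [j ->|->]; rewrite ?tnthS ?tnth_mktuple ?tnth0.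
Qed.

Definition contains_symbols L M (MM : structure L M) (F : family M) : Prop :=
  forall s : symbol L, F 'I_(arity s) (fun x => sym_interp MM s [tuple x i | i < arity s]).

Section Definability.
Context (L : language) (M : Type) (MM : structure L M).

Lemma teval_rename n m (s : 'I_n -> 'I_m) (t : term L n) (x : m.-tuple M) :
  teval MM x (rename_term s t) = teval MM [tuple tnth x (s i) | i < n] t.
Proof.
elim: t => [i|f a IHa] /=; first by rewrite tnth_mktuple.
by congr (fun_interp MM _ (mktuple _)); apply/funext => i.
Qed.

Lemma sat_rename n (phi : peform L n) m (s : 'I_n -> 'I_m) (x : m.-tuple M) :
  sat MM (rename_form phi s) x <-> sat MM phi [tuple tnth x (s i) | i < n].
Proof.
elim: phi m s x => {n} [n t u|n R a|n p IHp q IHq|n p IHp q IHq|n p IHp] m s x /=.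
- by rewrite !teval_rename.
- by under eq_mktuple do rewrite teval_rename.
- by rewrite IHp IHq.
- by rewrite IHp IHq.
have E y : [tuple tnth [tuple of y :: x] (shift_rename s i) | i < n.+1] =
           [tuple of y :: [tuple tnth x (s i) | i < n]].
  rewrite -mktuple_consf; congr mktuple; apply/funext => k.
  by rewrite /shift_rename /consf; case: unlift => [j|]; rewrite ?tnthS ?tnth0.
by split=> -[y]; exists y; move: p0; rewrite IHp E.
Qed.

Definition definable_family : family M := fun I A =>
  exists phi : peform L #|I|,
    forall x, A x <-> sat MM phi [tuple x (enum_val i) | i < #|I|].

Lemma definable_family_of n (phi : peform L n) (I : finType) (e : 'I_n -> I) :
  definable_family (fun x => sat MM phi [tuple x (e i) | i < n]).
Proof.
exists (rename_form phi (enum_rank \o e)) => x; rewrite sat_rename.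
by under [X in _ <-> sat _ _ X]eq_mktuple do rewrite tnth_mktuple /= enum_rankK.
Qed.

Lemma pe_definableE r (X : set (r.-tuple M)) :
  pe_definable MM X <-> definable_family (fun x : 'I_r -> M => X [tuple x i | i < r]).
Proof.
split=> [[phi ->]|[phi phiP]]; first exact: definable_family_of.
exists (rename_form phi enum_val); apply/funext => x; apply/propext.
by rewrite /= sat_rename -(phiP (tnth x)) mktuple_tnthK.
Qed.

Lemma definable_family_pp : inhabited M -> pp_closed definable_family.
Proof.
move=> [m0].
have dR (I J : finType) (s : I -> J) A : definable_family A ->
    definable_family (fun x : J -> M => A (x \o s)).
  move=> [phi phiP].
  apply: (eq_family _ (definable_family_of phi (s \o enum_val))) => x.
  by rewrite phiP.
have dE1 (I : finType) (A : set (option I -> M)) : definable_family A ->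
    definable_family (fun x => exists y, A (fun o => oapp x y o)).
  move=> [phi phiP].
  pose s (k : 'I_#|{: option I}|) : 'I_#|I|.+1 :=
    oapp (fun i : I => lift ord0 (enum_rank i)) ord0 (enum_val k).
  exists (PEx (rename_form phi s)) => x /=.
  have E y : [tuple tnth [tuple of y :: [tuple x (enum_val i) | i < #|I|]] (s i)
       | i < #|{: option I}|] = [tuple oapp x y (enum_val i) | i < #|{: option I}|].
    congr mktuple; apply/funext => k; rewrite /s.
    case: (enum_val k) => [i|] /=; last by rewrite tnth0.
    by rewrite tnthS tnth_mktuple enum_rankK.
  by split=> -[y Ay]; exists y; move: Ay; rewrite sat_rename E phiP.
split=> //.
(* Truth has to be expressed by [exists y, y = y], as without variables there may be no term at all;
   this is where [M] must be inhabited. *)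
- move=> I; exists (PEx (PEq (TVar L ord0) (TVar L ord0))) => x.
  by split=> // _; exists m0.
- move=> I A B [phi phiP] [psi psiP].
  by exists (PAnd phi psi) => x; rewrite /= -phiP -psiP.
- move=> I A B [phi phiP] [psi psiP].
  by exists (POr phi psi) => x; rewrite /= -phiP -psiP.
move=> I J.
(* The block [J] is numbered, so that its variables can be quantified one by one. *)
suff dE k A : definable_family A ->
    definable_family (fun x : I -> M => exists y : 'I_k -> M, A (sumf x y)).
  move=> A dA.
  have := dE _ _ (dR _ _ (fun s : I + J => match s with
    inl i => inl i | inr j => inr (enum_rank j) end) _ dA).
  apply: eq_family => x; split=> -[y Ay].
    exists (y \o enum_rank); apply: (eq_ind _ A Ay).
    by apply/funext => -[].
  exists (y \o enum_val); apply: (eq_ind _ A Ay).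
  by apply/funext => -[i|j] //=; rewrite enum_rankK.
elim: k A => [|k IHk] A dA.
  have y0 : 'I_0 -> M by case.
  have := dR _ _ (fun s : I + 'I_0 => match s with inl i => i
    | inr j => match notF (ltn_ord j) with end end) _ dA.
  apply: eq_family => x; split=> [Ax|[y Ay]].
    by exists y0; apply: (eq_ind _ A Ax); apply/funext => -[|[]].
  by apply: (eq_ind _ A Ay); apply/funext => -[|[]].
(* Variable 0 of the block becomes [None] and is quantified by [dE1]; the induction hypothesis
   quantifies the others. *)
have := IHk _ (dE1 _ _ (dR _ _ (fun s : I + 'I_k.+1 => match s with
    inl i => Some (inl i)
  | inr j => if unlift ord0 j is Some l then Some (inr l) else None end) _ dA)).
apply: eq_family => x; split=> [[y [u Ay]]|[y Ay]].
  exists (consf u y); apply: (eq_ind _ A Ay); apply/funext => -[i|j] //=.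
  by rewrite /consf; case: unlift.
exists (y \o lift ord0), (y ord0); apply: (eq_ind _ A Ay).
by apply/funext => -[i|j] //=; case: unliftP => [l ->|->].
Qed.

Lemma definable_family_symbols : contains_symbols MM definable_family.
Proof.
case=> [|f|R] /=.
- apply: eq_family (definable_family_of (PEq (TVar L ord0) (TVar L ord_max)) id).
  by [].
- apply: (eq_family _ (definable_family_of (PEq (TVar L ord0)
    (TApp (fun i : 'I_(farity f) => TVar L (lift ord0 i)))) id)) => x.
  suff -> : behead_tuple [tuple x i | i < (farity f).+1] =
            [tuple x (lift ord0 i) | i < farity f].
    by rewrite /= /thead !tnth_mktuple; under eq_mktuple do rewrite tnth_mktuple.
  apply: eq_from_tnth => i; rewrite tnth_behead !tnth_mktuple; congr x.
  by apply: val_inj; rewrite /= inordK // ltnS ltn_ord.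
- apply: (eq_family _ (definable_family_of
    (PRel (fun i : 'I_(rarity R) => TVar L i)) id)) => x.
  by rewrite /= mktuple_tnthK.
Qed.

Context (F : family M) (Fpp : pp_closed F) (Fsym : contains_symbols MM F).

(** [F] knows function symbols only through their graphs, so nested terms are flattened by
    quantifying over the values of the arguments. *)
Lemma pp_teval n (t : term L n) :
  F (fun z : 'I_n + unit -> M => z (inr tt) = teval MM [tuple z (inl i) | i < n] t).
Proof.
elim: t => [i|f a IHa].
  apply: (pp_rename Fpp (s := fun k : 'I_2 => if k == ord0 then inr tt else inl i)
    (Fsym SEq)) => x.
  by rewrite /= !tnth_mktuple /=.
apply: (pp_exists Fpp (J := 'I_(farity f))
  (A := fun z => fun_interp MM f [tuple z (inr j) | j < farity f] = z (inl (inr tt))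
   /\ forall j, z (inr j) = teval MM [tuple z (inl (inl i)) | i < n] (a j))).
  apply: (ppI Fpp).
    apply: (pp_rename Fpp (s := consf (inl (inr tt)) inr) (Fsym (SFun f))) => x /=.
    have -> : [tuple (x \o consf (inl (inr tt)) inr) i | i < (farity f).+1] =
       [tuple of x (inl (inr tt)) :: [tuple x (inr j) | j < farity f]].
      rewrite -mktuple_consf; congr mktuple; apply/funext => k.
      by rewrite /consf /=; case: unlift.
    rewrite theadE.
    have -> (u : M) (y : (farity f).-tuple M) : behead_tuple [tuple of u :: y] = y
      by apply: val_inj.
    by split.
  apply: (pp_forall Fpp) => j.
  by apply: (pp_rename Fpp (s := sumf (inl \o inl) (fun=> inr j)) (IHa j)).
move=> x; split=> [[y [/= xy ya]]|xt].
  rewrite -xy; congr fun_interp; congr mktuple; apply/funext => j; apply: ya.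
by exists (fun j => teval MM [tuple x (inl i) | i < n] (a j)).
Qed.

Lemma pp_sat n (phi : peform L n) :
  F (fun x : 'I_n -> M => sat MM phi [tuple x i | i < n]).
Proof.
elim: phi => {n} [n t u|n R a|n p IHp q IHq|n p IHp q IHq|n p IHp] /=.
(* An equation says that some element is the value of both terms. *)
- apply: (pp_exists Fpp (ppI Fpp (pp_teval t) (pp_teval u))) => x.
  by split=> [[y [/= <- <-]]//|tu]; exists (fun=> teval MM [tuple x i | i < n] t).
- apply: (pp_exists Fpp (J := 'I_(rarity R))
    (A := fun z => rel_interp MM R [tuple z (inr j) | j < rarity R]
     /\ forall j, z (inr j) = teval MM [tuple z (inl i) | i < n] (a j))).
    apply: (ppI Fpp).
      by apply: (pp_rename Fpp (s := inr) (Fsym (SRel R))).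
    apply: (pp_forall Fpp) => j.
    by apply: (pp_rename Fpp (s := sumf inl (fun=> inr j)) (pp_teval (a j))).
  move=> x; split=> [[y [Ry ya]]|Ra]; last by eexists; split; first exact: Ra.
  by apply: (eq_ind _ _ Ry); congr mktuple; apply/funext.
- exact: ppI.
- exact: ppU.
apply: (pp_exists Fpp (J := unit) (ppR Fpp (consf (inr tt) inl) IHp)) => x.
have E (y : unit -> M) : [tuple (sumf x y \o consf (inr tt) inl) i | i < n.+1] =
    [tuple of y tt :: [tuple x i | i < n]].
  rewrite -mktuple_consf; congr mktuple; apply/funext => k.
  by rewrite /consf /=; case: unlift.
split=> -[y]; first by rewrite E; exists (y tt).
by exists (fun=> y); rewrite E.
Qed.

Lemma pp_definable r (X : set (r.-tuple M)) :
  pe_definable MM X -> F (fun x : 'I_r -> M => X [tuple x i | i < r]).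
Proof. by move=> [phi ->]; apply: pp_sat. Qed.

End Definability.

(** * Pulling families back along a partial map *)

(** The counterpart of [pullback] for finite index types: pairs replace the block arithmetic. *)
Definition pullf r M N (theta : partial_map r M N) (I : finType)
    (S : set (I -> N)) : set (I * 'I_r -> M) :=
  fun z => (forall i, pdom theta [tuple z (i, a) | a < r]) /\
           S (fun i => theta [tuple z (i, a) | a < r]).

(** Regarding sets over [M] as a family over [N] lets [pp_definable] be applied to a structure on
    [N]. *)
Definition pullback_family r M N (theta : partial_map r M N) (F : family M) :
    family N := fun I S => F (I * 'I_r)%type (pullf theta S).

Definition block_index r k (p : 'I_k * 'I_r) : 'I_(r * k) :=
  Ordinal (block_index_subproof p.1 p.2).

(** Quotient and remainder by [r] recover the pair, and the cardinalities agree. *)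
Lemma block_index_bij r k : bijective (@block_index r k).
Proof.
apply: inj_card_bij; last by rewrite card_prod !card_ord mulnC.
move=> [j i] [j' i'] /(congr1 val) /= E.
have r_gt0 : 0 < r by apply: leq_trans (ltn_ord i).
congr pair; apply: val_inj.
  by have := congr1 (divn^~ r) E; rewrite /= !divnMDl // !divn_small ?addn0.
by have := congr1 (modn^~ r) E; rewrite /= !modnMDl !modn_small.
Qed.

Lemma pullback_mktuple r k M N (theta : partial_map r M N) (S : set (k.-tuple N))
    (x : 'I_(r * k) -> M) :
  pullback theta S [tuple x i | i < r * k] <->
  pullf theta (fun y => S [tuple y i | i < k]) (x \o @block_index r k).
Proof.
rewrite /pullback /pullf /partial_map_pow /block /=.
have E (j : 'I_k) : [tuple tnth [tuple x i | i < r * k]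
    (Ordinal (block_index_subproof j i)) | i < r] = [tuple x (block_index (j, a)) | a < r].
  by congr mktuple; apply/funext => a; rewrite tnth_mktuple.
under eq_forall do rewrite E.
by under [X in S X]eq_mktuple do rewrite E.
Qed.

Section PullbackFamily.
Context (M N : Type) (r : nat) (theta : partial_map r M N) (F : family M).
Hypotheses (Fpp : pp_closed F) (onto : theta @` pdom theta = setT).

Lemma pullf_surj (I : finType) (y : I -> N) :
  exists2 z : I * 'I_r -> M, (forall i, pdom theta [tuple z (i, a) | a < r]) &
    y = fun i => theta [tuple z (i, a) | a < r].
Proof.
have /choice[z zP] i : exists t, pdom theta t /\ theta t = y i.
  have : setT (y i) by []; by rewrite -onto => -[t dt <-]; exists t.
exists (fun p => tnth (z p.1) p.2).
  by move=> i; rewrite /= mktuple_tnthK; case: (zP i).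
by apply/funext => i; rewrite /= mktuple_tnthK; case: (zP i).
Qed.

Lemma pullback_familyE k (S : set (k.-tuple N)) :
  F (fun x : 'I_(r * k) -> M => pullback theta S [tuple x i | i < r * k]) <->
  pullback_family theta F (fun y : 'I_k -> N => S [tuple y i | i < k]).
Proof.
split=> FS; last first.
  apply: (pp_rename Fpp (s := @block_index r k) FS) => x.
  by rewrite pullback_mktuple.
have [s sK Ks] := block_index_bij r k.
apply: (pp_rename Fpp (s := s) FS) => x; rewrite pullback_mktuple.
by have -> : (x \o s) \o @block_index r k = x by apply/funext => p; rewrite /= sK.
Qed.

Hypothesis Fdom : F (fun x : 'I_r -> M => pdom theta [tuple x i | i < r]).

Lemma pullback_family_pp : pp_closed (pullback_family theta F).
Proof.
have Fd (I : finType) : F (fun z : I * 'I_r -> M =>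
    forall i, pdom theta [tuple z (i, a) | a < r]).
  by apply: (pp_forall Fpp) => i; apply: (pp_rename Fpp (s := pair i) Fdom).
split.
(* The pullback of the full set is the domain condition, not the full set. *)
- by move=> I; apply: eq_family (Fd I) => z; split=> [|[]].
- move=> I A B FA FB; apply: (eq_family _ (ppI Fpp FA FB)) => z.
  by split=> [[[d Az] [_ Bz]]|[d [Az Bz]]].
- move=> I A B FA FB; apply: (eq_family _ (ppU Fpp FA FB)) => z.
  by split=> [[] [d ?]|[d [?|?]]]; [split=> //; left | split=> //; right | left | right].
- move=> I J s A FA.
  (* The renamed set constrains only the indices in the range of [s]; the domain condition at the
     others is added by [Fd J]. *)
  have := ppI Fpp (Fd J) (ppR Fpp (J := (J * 'I_r)%type) (fun p => (s p.1, p.2)) FA).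
  rewrite /pullback_family; apply: eq_family => z.
  by split=> [[d [_ Az]]|[d Az]]; split=> //; split=> // i; exact: (d (s i)).
move=> I J A FA.
have := ppI Fpp (Fd I) (ppE Fpp (ppR Fpp (J := (I * 'I_r + J * 'I_r)%type)
  (fun p => match p with
  | (inl i, a) => inl (i, a) | (inr j, a) => inr (j, a) end) FA)).
rewrite /pullback_family; apply: eq_family => z; split=> [[dz [w [dw Aw]]]|[dz [y]]].
  split=> //; exists (fun j => theta [tuple w (j, a) | a < r]).
  by apply: (eq_ind _ A Aw); apply/funext => -[].
(* Surjectivity of [theta] lifts the witness in [N] to codes in [M]. *)
have [w dw ->] := pullf_surj y => Aw.
split=> //; exists w; split=> [[i|j]|]; [exact: dz|exact: dw|].
by apply: (eq_ind _ A Aw); apply/funext => -[].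
Qed.

End PullbackFamily.

(** * Listability through a presentation *)

(** Only projection needs surjectivity of [rho]: a witness in [M] must have a code. *)
Lemma listable_pullback_pp M (rho : nat -> M) : range rho = setT ->
  pp_closed (fun I A => listable_family (fun x : I -> nat => A (rho \o x))).
Proof.
move=> onto; have lpp := listable_family_pp.
split=> [I|I A B FA FB|I A B FA FB|I J s A FA|I J A FA].
- exact: (ppT lpp).
- exact: (ppI lpp FA FB).
- exact: (ppU lpp FA FB).
- exact: (ppR lpp s FA).
apply: (pp_exists lpp FA) => x; split=> -[y Ay].
  by exists (rho \o y); apply: (eq_ind _ A Ay); apply/funext => -[].
have /choice[n nP] j : exists n, rho n = y j.
  have : setT (y j) by []; by rewrite -onto => -[n _ <-]; exists n.
exists n; apply: (eq_ind _ A Ay); apply/funext => -[i|j] //=.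
Qed.

Lemma map_mktuple U V (h : U -> V) r (x : 'I_r -> U) :
  map_tuple h [tuple x i | i < r] = [tuple h (x i) | i < r].
Proof. by apply: eq_from_tnth => i; rewrite tnth_map !tnth_mktuple. Qed.

Lemma listable_preimageE M (rho : nat -> M) r (X : set (r.-tuple M)) :
  listable (map_tuple rho @^-1` X) <->
  listable_family (fun x : 'I_r -> nat => X [tuple rho (x i) | i < r]).
Proof.
by rewrite listableE; split; apply: eq_family => x; rewrite /preimage /= map_mktuple.
Qed.

(** The pairs [(f n, n)] are enumerated with index type [bool] and then renamed to the coordinates
    [i] and [j]. *)
Lemma listable_graph f (I : finType) (i j : I) : total_recursive f ->
  listable_family (fun z : I -> nat => z i = f (z j)).
Proof.
move=> fr; apply: (pp_rename listable_family_pp (s := fun b : bool => if b then i else j)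
  (A := fun y => y true = f (y false))) => //.
exists (fun=> 0), (fun b => if b then f else id); split=> [|[]|x] //.
- exact: total_recursive_const.
- exact: total_recursive_id.
split=> [xf|[n [_ xf]]]; last by rewrite !xf.
by exists (x false); split=> // -[].
Qed.

Lemma Gamma_consf r M (theta : partial_map r M M) u (x : 'I_r -> M) :
  Gamma theta [tuple consf u x i | i < r.+1] <->
  pdom theta [tuple x i | i < r] /\ u = theta [tuple x i | i < r].
Proof.
rewrite mktuple_consf /Gamma /= theadE.
by have -> : behead_tuple [tuple of u :: [tuple x i | i < r]] = [tuple x i | i < r]
  by apply: val_inj.
Qed.

(** * Composition of partial maps *)

Section Composition.
Context (r1 r2 : nat) (M1 M2 M3 : Type).
Context (theta1 : partial_map r1 M1 M2) (theta2 : partial_map r2 M2 M3).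

(** The iterated pullback has variables in [I * 'I_r2 * 'I_r1], the composite in [I * 'I_(r1 * r2)];
    [block_index] matches them. *)
Lemma pullf_comp (I : finType) (S : set (I -> M3)) z :
  pullf (interp_comp theta2 theta1) S z <->
  pullf theta1 (pullf theta2 S)
    (fun p => z (p.1.1, block_index (p.1.2, p.2))).
Proof.
have E i b : block [tuple z (i, a) | a < r1 * r2] b =
             [tuple z (i, block_index (b, a)) | a < r1].
  by apply: eq_from_tnth => a; rewrite !tnth_mktuple.
have E' i : partial_map_pow theta1 [tuple z (i, a) | a < r1 * r2] =
            [tuple theta1 [tuple z (i, block_index (b, a)) | a < r1] | b < r2].
  by apply: eq_from_tnth => b; rewrite !tnth_mktuple E.
rewrite /pullf /= /pullback /=; split.
- move=> [d s]; split; first by move=> [i b] /=; rewrite -E; case: (d i).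
  split; first by move=> i; rewrite -E'; case: (d i).
  by apply: (eq_ind _ S s); apply/funext => i; rewrite E'.
move=> [d1 [d2 s]]; split.
  by move=> i; split=> [b|]; rewrite ?E ?E'; [exact: (d1 (i, b)) | exact: d2].
by apply: (eq_ind _ S s); apply/funext => i; rewrite E'.
Qed.

Lemma pullback_family_comp (F : family M1) (I : finType) (S : set (I -> M3)) :
  pp_closed F -> pullback_family theta2 (pullback_family theta1 F) S ->
  pullback_family (interp_comp theta2 theta1) F S.
Proof.
move=> Fpp FS.
apply: (pp_rename Fpp (s := fun p => (p.1.1, block_index (p.1.2, p.2))) FS) => z.
by rewrite pullf_comp.
Qed.

Lemma interp_comp_onto :
  theta1 @` pdom theta1 = setT -> theta2 @` pdom theta2 = setT ->
  interp_comp theta2 theta1 @` pdom (interp_comp theta2 theta1) = setT.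
Proof.
move=> onto1 onto2; apply/seteqP; split=> // u _.
have [y dy uy] := pullf_surj onto2 (fun _ : unit => u).
have [w dw yw] := pullf_surj onto1 y.
have [s sK Ks] := block_index_bij r1 r2.
pose z (p : unit * 'I_(r1 * r2)) := w (p.1, (s p.2).1, (s p.2).2).
(* Taking the singleton of [u] as the set makes [pullf_comp] yield the domain condition and the
   value together. *)
suff [d /(congr1 (@^~ tt)) e] : pullf (interp_comp theta2 theta1) (eq (fun=> u)) z.
  by exists [tuple z (tt, a) | a < r1 * r2]; [exact: d | rewrite e].
apply/pullf_comp; rewrite /z /=.
suff -> : (fun p : unit * 'I_r2 * 'I_r1 => w (p.1.1, (s (block_index (p.1.2, p.2))).1,
    (s (block_index (p.1.2, p.2))).2)) = w by split; rewrite -?yw.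
by apply/funext => -[[i b] a]; rewrite /= sK.
Qed.

End Composition.

(** * Transfer of presentations and totally listable sets along interpretations *)

Section Interpretation.
Context (L K : language) (M N : Type) (MM : structure L M) (NN : structure K N).
Context (r : nat) (theta : partial_map r M N).
Hypothesis theta_pe : pe_interpretation MM NN theta.

Section Family.
Context (F : family M) (Fpp : pp_closed F) (Fsym : contains_symbols MM F).

Lemma interpretation_pp : pp_closed (pullback_family theta F).
Proof.
case: theta_pe => onto dom _; apply: pullback_family_pp => //.
exact: pp_definable dom.
Qed.

Lemma interpretation_symbols : contains_symbols NN (pullback_family theta F).
Proof.
move=> s; apply/(pullback_familyE theta Fpp); case: theta_pe => _ _ /(_ s).
exact: pp_definable.
Qed.

End Family.

(** The new presentation sends [n] to the image under [theta] of the [n]-th code in an enumeration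
    [f] of the domain. Keeping [f] in the conclusion lets later proofs pass between codes and
    parameters. *)
Lemma presentation_interpretation rho : listable_presentation MM rho ->
  exists f : 'I_r -> nat -> nat,
  [/\ forall a, total_recursive (f a),
      forall x : 'I_r -> nat, pdom theta [tuple rho (x a) | a < r] <->
        exists n, forall a, x a = f a n &
      listable_presentation NN (fun n => theta [tuple rho (f a n) | a < r])].
Proof.
move=> [rho_onto rho_sym]; have [onto dom _] := theta_pe.
have lpp := listable_family_pp.
have Fpp := listable_pullback_pp rho_onto; set F := (F in pp_closed F) in Fpp.
have Fsym : contains_symbols MM F by move=> s; apply/listable_preimageE.
have rhoK (I : finType) (y : I -> M) : exists x, y = rho \o x.
  have /choice[x xP] i : exists n, rho n = y i.
    have : setT (y i) by []; by rewrite -rho_onto => -[n _ <-]; exists n.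
  by exists x; apply/funext => i /=.
have thetaK u : exists2 x : 'I_r -> nat, pdom theta [tuple rho (x a) | a < r] &
    u = theta [tuple rho (x a) | a < r].
  have : setT u by []; rewrite -onto => -[t dt <-].
  have [x xP] := rhoK _ (tnth t).
  have tE : [tuple rho (x a) | a < r] = t.
    by rewrite -[RHS]mktuple_tnthK xP.
  by exists x; rewrite tE.
have /listable_preimageE : F 'I_r (fun x => pdom theta [tuple x a | a < r]).
  exact: pp_definable dom.
(* The domain is not empty: [theta] at an arbitrary tuple is an element of [N], and surjectivity
   gives it a code in the domain. *)
case=> [dom0|[f fr fP]].
  have [x dx _] := thetaK (theta [tuple rho 0 | a < r]).
  suff : set0 [tuple x a | a < r] by [].
  by rewrite -dom0 /preimage /= map_mktuple.
have domP (x : 'I_r -> nat) : pdom theta [tuple rho (x a) | a < r] <->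
        exists n, forall a, x a = f a n.
  rewrite -map_mktuple -[pdom _ _]/((map_tuple rho @^-1` pdom theta) _) fP; split.
    by move=> [n _ /(congr1 (@tnth _ _))]; rewrite !tnth_mktupleK => <-; exists n.
  by move=> [n xn]; exists n => //; congr mktuple; apply/funext => a.
exists f; split=> //; split.
  apply/seteqP; split=> // u _; have [x /domP[n xn] ->] := thetaK u.
  by exists n => //; congr (theta _); apply: eq_mktuple => a; rewrite xn.
move=> s; apply/listable_preimageE.
have Gs := interpretation_symbols Fpp Fsym s.
set k := arity s in Gs *; set S := sym_interp NN s in Gs *.
(* The parameters [x] satisfy [s] iff the codes [f] assigns to them lie in the pullback of [s]; the
   graph of [f] is listable. *)
apply: (pp_exists lpp (I := 'I_k) (J := ('I_k * 'I_r)%type)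
  (A := fun z => (forall p, z (inr p) = f p.2 (z (inl p.1))) /\
    pullf theta (fun y => S [tuple y i | i < k]) (rho \o (z \o inr)))).
  apply: (ppI lpp); last exact: (ppR lpp inr Gs).
  by apply: (pp_forall lpp) => p; apply: listable_graph.
move=> x; split=> [[w [/= wE [_ ]]]|Sx].
  move=> Sw; apply: (eq_ind _ S Sw); congr mktuple; apply/funext => i.
  by congr (theta _); apply: eq_mktuple => a; rewrite /= wE.
exists (fun p => f p.2 (x p.1)); split=> //; split=> // i.
by apply/(domP (fun a => f a (x i))); exists (x i).
Qed.

(** The codes in the pullback are the outputs of [f] at parameters in the preimage of [X] under the
    transferred presentation, so they form a projection of a listable set. *)
Lemma totally_listable_pullback k (X : set (k.-tuple N)) :
  totally_listable NN X -> totally_listable MM (pullback theta X).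
Proof.
move=> X_tl rho rho_pres; have lpp := listable_family_pp.
have [f [fr domP gamma_pres]] := presentation_interpretation rho_pres.
have /listable_preimageE Xl := X_tl _ gamma_pres; apply/listable_preimageE.
suff H : listable_family (fun w : 'I_k * 'I_r -> nat =>
    pullf theta (fun y => X [tuple y i | i < k]) (rho \o w)).
  apply: (pp_rename lpp (s := @block_index r k) H) => x.
  by rewrite (pullback_mktuple _ _ (rho \o x)).
apply: (pp_exists lpp (J := 'I_k)
  (A := fun z => (forall p, z (inl p) = f p.2 (z (inr p.1))) /\
    X [tuple theta [tuple rho (f a (z (inr i))) | a < r] | i < k])).
  apply: (ppI lpp); last exact: (ppR lpp inr Xl).
  by apply: (pp_forall lpp) => p; apply: listable_graph.
move=> w; split=> [[x [/= wE Xw]]|[dw Xw]].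
  split=> [i|]; first by apply/(domP (fun a => w (i, a))); exists (x i).
  apply: (eq_ind _ X Xw); apply: eq_mktuple => i.
  by congr (theta _); apply: eq_mktuple => a /=; rewrite wE.
have /choice[x xP] i : exists n, forall a, w (i, a) = f a n.
  exact/(domP (fun a => w (i, a)))/dw.
exists x; split=> [[i a]|] /=; first exact: xP.
apply: (eq_ind _ X Xw); apply: eq_mktuple => i.
by congr (theta _); apply: eq_mktuple => a /=; rewrite xP.
Qed.

End Interpretation.

(** Pulling the definable sets over [MM1] back twice gives a closed family containing the symbols of
    [MM3]. *)
Lemma interp_comp_pe L1 L2 L3 M1 M2 M3 (MM1 : structure L1 M1)
    (MM2 : structure L2 M2) (MM3 : structure L3 M3) r1 r2
    (theta1 : partial_map r1 M1 M2) (theta2 : partial_map r2 M2 M3) :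
  inhabited M1 -> pe_interpretation MM1 MM2 theta1 ->
  pe_interpretation MM2 MM3 theta2 ->
  pe_interpretation MM1 MM3 (interp_comp theta2 theta1).
Proof.
move=> M1_inh pe1 pe2; have [onto1 _ _] := pe1; have [onto2 dom2 _] := pe2.
have Fpp := definable_family_pp MM1 M1_inh.
have Fsym := @definable_family_symbols _ _ MM1.
have Gpp := interpretation_pp pe1 Fpp Fsym.
have Gsym := interpretation_symbols pe1 Fpp Fsym.
split; first exact: interp_comp_onto.
  apply/pe_definableE/(pullback_familyE _ Fpp).
  exact: pp_definable dom2.
move=> s; apply/pe_definableE/(pullback_familyE _ Fpp)/(pullback_family_comp Fpp).
exact: (interpretation_symbols pe2 Gpp Gsym).
Qed.

(** * Graphs of self-interpretations and the equivalence *)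

Lemma totally_listable_Gamma L M (MM : structure L M) r (theta : partial_map r M M) :
  uniquely_listable MM -> pe_interpretation MM MM theta ->
  totally_listable MM (Gamma theta).
Proof.
move=> [_ uniq] theta_pe rho rho_pres; have lpp := listable_family_pp.
have [f [fr domP gamma_pres]] := presentation_interpretation theta_pe rho_pres.
have [phi phir phiE] := uniq _ _ rho_pres gamma_pres.
have /listable_preimageE eql := rho_pres.2 SEq; apply/listable_preimageE.
(* Index [false] holds the parameter [n] and [true] holds [phi n]. As [rho] need not be injective,
   the value is compared with [rho (phi n)] through the listable preimage of equality. *)
apply: (pp_exists lpp (J := bool)
  (A := fun z => (forall a, z (inl (lift ord0 a)) = f a (z (inr false))) /\
    (z (inr true) = phi (z (inr false)) /\ rho (z (inl ord0)) = rho (z (inr true))))).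
  apply: (ppI lpp); last apply: (ppI lpp).
  - by apply: (pp_forall lpp) => a; apply: listable_graph.
  - exact: listable_graph.
  apply: (pp_rename lpp (s := fun i : 'I_2 =>
    if i == ord0 then inl ord0 else inr true) eql) => z.
  by rewrite /= !tnth_mktuple.
move=> x.
have -> : [tuple rho (x i) | i < r.+1] =
    [tuple consf (rho (x ord0)) (fun a => rho (x (lift ord0 a))) i | i < r.+1].
  by apply: eq_mktuple => i; rewrite /consf; case: unliftP => [j|] ->.
rewrite Gamma_consf (domP (fun a => x (lift ord0 a))).
split=> [[m [/= xE [mE ->]]]|[[n xE] x0E]].
  split; first by exists (m false).
  rewrite mE -[LHS]/((rho \o phi) _) -phiE.
  by congr (theta _); apply: eq_mktuple => a; rewrite xE.
exists (fun b => if b then phi n else n); split=> //=; split=> //.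
rewrite x0E -[RHS]/((rho \o phi) _) -phiE.
by congr (theta _); apply: eq_mktuple => a; rewrite xE.
Qed.

Theorem theorem4p8 (L1 L2 : language) (M1 M2 : Type)
    (MM1 : structure L1 M1) (MM2 : structure L2 M2)
    (r1 r2 : nat) (theta1 : partial_map r1 M1 M2) (theta2 : partial_map r2 M2 M1) :
  uniquely_listable MM1 ->
  uniquely_listable MM2 ->
  DPRM MM2 ->
  pe_interpretation MM1 MM2 theta1 ->
  pe_interpretation MM2 MM1 theta2 ->
  [<-> pe_bi_interpretation MM1 MM2 theta1 theta2;
       pe_definable MM1 (Gamma (interp_comp theta2 theta1));
       DPRM MM1].
Proof.
move=> ul1 ul2 dprm2 pe1 pe2.
have inh1 : inhabited M1 by case: ul1 => -[rho _] _; exists; exact: rho 0.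
have inh2 : inhabited M2 by case: ul2 => -[rho _] _; exists; exact: rho 0.
have pe12 := interp_comp_pe inh1 pe1 pe2.
have pe21 := interp_comp_pe inh2 pe2 pe1.
tfae=> [[]//|Gamma_def r X X_tl|dprm1].
  have Fpp := definable_family_pp MM1 inh1.
  have Fsym := @definable_family_symbols _ _ MM1.
  have Gpp := interpretation_pp pe1 Fpp Fsym.
  have Gsym := interpretation_symbols pe1 Fpp Fsym.
  have X2 := dprm2 _ _ (totally_listable_pullback pe2 X_tl).
  (* The sets with definable pullback along [theta1] include the pullback of [X] along [theta2], and
     the two pullbacks compose. *)
  have /(pullback_familyE _ Gpp) /(pullback_family_comp Fpp) XF :=
    pp_definable Gpp Gsym X2.
  move/pe_definableE: Gamma_def => GF.
  apply/pe_definableE; set zeta := interp_comp theta2 theta1 in pe12 XF GF *.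
  (* [x] lies in [X] iff its coordinates have [zeta]-codes that jointly lie in
     the pullback of [X]; the graph of [zeta] makes this p.e. *)
  apply: (pp_exists Fpp (J := ('I_r * 'I_(r1 * r2))%type)
    (A := fun z => (forall j, Gamma zeta [tuple consf (z (inl j))
        (fun a => z (inr (j, a))) i | i < (r1 * r2).+1]) /\
      pullf zeta (fun y => X [tuple y i | i < r]) (z \o inr))).
    apply: (ppI Fpp); last exact: (ppR Fpp inr XF).
    apply: (pp_forall Fpp) => j.
    apply: (pp_rename Fpp (s := consf (inl j) (fun a => inr (j, a))) GF) => z.
    have -> // : [tuple (z \o consf (inl j) (fun a => inr (j, a))) i
        | i < (r1 * r2).+1] = [tuple consf (z (inl j))
        (fun a => z (inr (j, a))) i | i < (r1 * r2).+1].
    by apply: eq_mktuple => i; rewrite /consf /=; case: unlift.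
  have [onto _ _] := pe12.
  move=> x; split=> [[w [/= Gw [_ Xw]]]|].
    apply: (eq_ind _ X Xw); apply: eq_mktuple => j.
    by have /Gamma_consf[_ ->] := Gw j.
  have [w dw ->] := pullf_surj onto x => Xw.
  by exists w; split=> [j|]; [apply/Gamma_consf; split=> /=; [exact: dw|] | split].
(* Both composites interpret a uniquely listable structure in itself, so both graphs are totally
   listable, and the DPRM property on each side defines them. *)
split=> //; [apply: dprm2 | apply: dprm1]; exact: totally_listable_Gamma.
Qed.
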